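(* Let $\mu$ be a $\Gamma_d(\alpha,\beta)$ distribution on $\mathbb{R}^d$ (with respect to a norm $\|\cdot\|$). Then its characteristic function is given by $$\hat\mu(z)=\exp\left(\int_{\mathbf{S}_{\mathbb{R}^d,\|\cdot\|}}\ln\left(\frac{\beta(v)}{\beta(v)-iv^\top z}\right)\alpha(\mathrm{d}v)\right)\quad\text{for all }z\in\mathbb{R}^d,$$ where $\ln$ is the main branch of the complex logarithm.
   Context: $\mathbb{R}_+=[0,\infty)$ and $\mathbf{S}_{\mathbb{R}^d,\|\cdot\|}=\{v\in\mathbb{R}^d:\|v\|=1\}$. For a finite Borel measure $\alpha$ on $\mathbf{S}_{\mathbb{R}^d,\|\cdot\|}$ and a Borel function $\beta:\mathbf{S}_{\mathbb{R}^d,\|\cdot\|}\to\mathbb{R}_+$, an infinitely divisible probability measure $\mu$ on $\mathbb{R}^d$ is called a $d$-dimensional Gamma distribution $\Gamma_d(\alpha,\beta)$ if its characteristic function is $$\hat\mu(z)=\int e^{iz^\top x}\mu(\mathrm{d}x)=\exp\left(\int_{\mathbf{S}_{\mathbb{R}^d,\|\cdot\|}}\int_{\mathbb{R}_+}\left(e^{irv^\top z}-1\right)\frac{e^{-\beta(v)r}}{r}\,\mathrm{d}r\,\alpha(\mathrm{d}v)\right),\quad z\in\mathbb{R}^d,$$ i.e. $\mu$ has no Gaussian part, no drift, and Lévy measure $\nu_\mu(E)=\int_{\mathbf{S}_{\mathbb{R}^d,\|\cdot\|}}\int_{\mathbb{R}_+}1_E(rv)\frac{e^{-\beta(v)r}}{r}\,\mathrm{d}r\,\alpha(\mathrm{d}v)$.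 (In particular existence of $\mu$ means that this $\nu_\mu$ is a Lévy measure, which forces $\beta>0$ $\alpha$-a.e.) *)

(* Defs.v *)
From HB Require Import structures.
From mathcomp Require Import all_boot all_order all_algebra.
From mathcomp Require Import all_classical all_reals all_analysis.
From mathcomp Require Import complex.

Set Implicit Arguments.
Unset Strict Implicit.
Unset Printing Implicit Defensive.
Import Order.TTheory GRing.Theory Num.Theory.
Import numFieldNormedType.Exports.

Local Open Scope classical_set_scope.
Local Open Scope ring_scope.
Local Open Scope complex_scope.

Section ComplexFunctions.
Variable R : realType.

Definition cexp (w : R[i]) : R[i] :=
  (expR (complex.Re w))%:C * (cos (complex.Im w) +i* sin (complex.Im w)).

Definition cmod (w : R[i]) : R :=
  Num.sqrt (complex.Re w ^+ 2 + complex.Im w ^+ 2).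

(* The principal argument, in ]-pi, pi]. *)
Definition carg (w : R[i]) : R :=
  if 0 <= complex.Im w then acos (complex.Re w / cmod w)
  else - acos (complex.Re w / cmod w).

(* The main branch of the logarithm; [cexp_cln] and [Im_cln] characterize it
   for w != 0, and cln 0 is a junk value. *)
Definition cln (w : R[i]) : R[i] := ln (cmod w) +i* carg w.

Lemma cmod_gt0 w : w != 0 -> 0 < cmod w.
Proof.
case: w => a b; rewrite eq_complex /= negb_and /cmod sqrtr_gt0 /= => h.
rewrite lt_neqAle eq_sym addr_ge0 ?sqr_ge0 // andbT.
by rewrite paddr_eq0 ?sqr_ge0 // !sqrf_eq0 negb_and.
Qed.

Lemma cmod_cos_bound w : w != 0 -> -1 <= complex.Re w / cmod w <= 1.
Proof.
move=> w0; have m0 := cmod_gt0 w0.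
rewrite -ler_norml normrM normfV (gtr0_norm m0) ler_pdivrMr // mul1r.
by rewrite /cmod -sqrtr_sqr ler_wsqrtr // lerDl sqr_ge0.
Qed.

Lemma cexp_cln w : w != 0 -> cexp (cln w) = w.
Proof.
move=> w0; have m0 := cmod_gt0 w0; have b := cmod_cos_bound w0.
have mK : cmod w ^+ 2 = complex.Re w ^+ 2 + complex.Im w ^+ 2.
  by rewrite /cmod sqr_sqrtr // addr_ge0 ?sqr_ge0.
have hc : cos (carg w) = complex.Re w / cmod w.
  by rewrite /carg; case: ifP => _; rewrite ?cosN acosK // in_itv.
have hs : sin (carg w) = complex.Im w / cmod w.
  have -> : sin (carg w) =
      (if 0 <= complex.Im w then 1 else -1) * (`|complex.Im w| / cmod w).
    have -> : `|complex.Im w| / cmod w = sin (acos (complex.Re w / cmod w)).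
      rewrite sin_acos // expr_div_n.
      have -> : 1 - complex.Re w ^+ 2 / cmod w ^+ 2 =
          (complex.Im w / cmod w) ^+ 2.
        rewrite expr_div_n -[X in X - _](@divff _ (cmod w ^+ 2)).
          by rewrite -mulrBl mK addrC addKr.
        by rewrite expf_neq0 // gt_eqF.
      by rewrite sqrtr_sqr normrM normfV (gtr0_norm m0).
    by rewrite /carg; case: ifP => _; rewrite ?sinN ?mul1r ?mulN1r.
  case: ifPn => h; first by rewrite ger0_norm // mul1r.
  by rewrite ltr0_norm ?ltNge // mulN1r mulNr opprK.
rewrite /cexp /= hc hs lnK ?posrE //.
move: m0; case: w {w0 b mK hc hs} => a b /= m0.
by rewrite /real_complex_def; congr (_ +i* _);
   rewrite mul0r ?subr0 ?addr0 mulrC divfK // gt_eqF.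
Qed.

Lemma Im_cln w : w != 0 -> - pi < complex.Im (cln w) <= pi.
Proof.
move=> w0; have b := cmod_cos_bound w0; have m0 := cmod_gt0 w0.
have h0 := acos_ge0 b; have h1 := acos_lepi b.
rewrite /cln /= /carg; case: ifPn => h.
  by rewrite h1 andbT (lt_le_trans _ h0) // oppr_lt0 pi_gt0.
rewrite (le_trans _ (pi_ge0 R)) ?oppr_le0 // andbT ltrN2.
apply: acos_ltpi; case/andP: b => bl ->; rewrite andbT lt_neqAle bl andbT.
apply/eqP => e; have : complex.Im w ^+ 2 = 0.
  have mK : cmod w ^+ 2 = complex.Re w ^+ 2 + complex.Im w ^+ 2.
    by rewrite /cmod sqr_sqrtr // addr_ge0 ?sqr_ge0.
  have er : complex.Re w = - cmod w.
    by rewrite -[LHS](divfK (lt0r_neq0 m0)) -e mulN1r.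
  by move/esym/eqP: mK; rewrite er sqrrN -subr_eq0 addrAC subrr add0r => /eqP.
by move/eqP; rewrite sqrf_eq0 => /eqP h'; rewrite h' lexx in h.
Qed.

End ComplexFunctions.

Section ComplexIntegral.
Context {R : realType} {disp : measure_display} {T : measurableType disp}.
Variable mu : {measure set T -> \bar R}.

Definition cintegrable (D : set T) (f : T -> R[i]) : Prop :=
  mu.-integrable D (EFin \o (fun x => complex.Re (f x))) /\
  mu.-integrable D (EFin \o (fun x => complex.Im (f x))).

(* Meaningful when [cintegrable D f] holds. *)
Definition cintegral (D : set T) (f : T -> R[i]) : R[i] :=
  (\int[mu]_(x in D) complex.Re (f x)) +i* (\int[mu]_(x in D) complex.Im (f x)).

End ComplexIntegral.

(* R^d as column vectors, equipped with its Borel sigma-algebra. *)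
Notation borelRd R d := (g_sigma_algebraType (@open 'cV[R]_d)).

Section GammaDistribution.
Context {R : realType} {d : nat}.
Local Notation V := (borelRd R d).

Definition dotv (x y : 'cV[R]_d) : R := (x^T *m y) 0 0.

Record is_norm (N : 'cV[R]_d -> R) : Prop := IsNorm {
  norm_triangle : forall x y, N (x + y) <= N x + N y ;
  norm_homogeneous : forall a x, N (a *: x) = `|a| * N x ;
  norm_definite : forall x, N x = 0 -> x = 0 }.

Definition unit_sphere (N : 'cV[R]_d -> R) : set V := [set v | N v = 1].

Definition charfun (mu : probability V R) (z : 'cV[R]_d) : R[i] :=
  cintegral mu setT (fun x : V => cexp ('i * (dotv z x)%:C)).

Definition convolution (m1 m2 : set V -> \bar R) : set V -> \bar R :=
  fun E => (\int[m1]_x m2 [set y : V | E ((x : 'cV[R]_d) + y)%R])%E.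

Definition infinitely_divisible (mu : probability V R) : Prop :=
  forall n : nat, (0 < n)%N -> exists rho : probability V R,
    forall E : set V, measurable E ->
      mu E = iter n (convolution rho) \d_((0 : 'cV[R]_d) : V) E.

Definition levy_measure (nu : {measure set V -> \bar R}) : Prop :=
  nu [set (0 : 'cV[R]_d)] = 0%E /\
  (\int[nu]_x (Num.min 1 (dotv x x))%:E < +oo)%E.

(* In polar coordinates x = r v, the set function
   nu(E) = int_S int_0^oo 1_E(r v) exp(- beta(v) r) / r dr alpha(dv). *)
Definition gamma_levy (N : 'cV[R]_d -> R)
    (alpha : {finite_measure set V -> \bar R}) (beta : V -> R)
    (E : set V) : \bar R :=
  (\int[alpha]_(v in unit_sphere N)
     \int[lebesgue_measure]_(r in `[0%R, +oo[)
       (\1_E (r *: (v : 'cV[R]_d)) * (expR (- beta v * r) / r))%R%:E)%E.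

Definition gamma_exponent (N : 'cV[R]_d -> R)
    (alpha : {finite_measure set V -> \bar R}) (beta : V -> R)
    (z : 'cV[R]_d) : R[i] :=
  cintegral alpha (unit_sphere N) (fun v : V =>
    cintegral lebesgue_measure `[0, +oo[ (fun r : R =>
      (cexp ('i * (r * dotv v z)%:C) - 1) * (expR (- beta v * r) / r)%:C)).

(* mu is a Gamma_d(alpha, beta) distribution with respect to the norm N.  A
   finite Borel measure on the unit sphere is represented by a finite Borel
   measure alpha on R^d that does not charge the complement of the sphere; the
   values of beta outside the sphere are irrelevant.  [gamma_is_levy] is what
   makes the (total) integrals in [gamma_exponent] meaningful. *)
Record is_gamma (N : 'cV[R]_d -> R)
    (alpha : {finite_measure set V -> \bar R}) (beta : V -> R)
    (mu : probability V R) : Prop := IsGamma {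
  gamma_alpha_sphere : alpha (~` unit_sphere N) = 0%E ;
  gamma_beta_measurable : measurable_fun (unit_sphere N) beta ;
  gamma_beta_ge0 : forall v, unit_sphere N v -> 0 <= beta v ;
  gamma_infdiv : infinitely_divisible mu ;
  gamma_is_levy : exists nu : {measure set V -> \bar R},
    (forall E, measurable E -> nu E = gamma_levy N alpha beta E) /\
    levy_measure nu ;
  gamma_charfun : forall z, charfun mu z = cexp (gamma_exponent N alpha beta z)
}.

End GammaDistribution.

(* Main.v *)
(* For beta > 0 the functions
     t |-> int_0^oo (cos (t r) - 1) exp (- beta r) / r dr  and
     t |-> int_0^oo sin (t r) exp (- beta r) / r dr
   vanish at 0, and differentiating under the integral sign gives the Laplace
   transforms - t / (beta^2 + t^2) and beta / (beta^2 + t^2).  Hence they are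
   - ln (1 + (t / beta)^2) / 2 and atan (t / beta), the real and imaginary parts
   of ln (beta / (beta - i t)).

   Only nu {x | 1 <= |x|} < oo is needed from the Levy condition (|.| is the
   Euclidean norm).  In polar coordinates it bounds the alpha-integral of
   int_(1/|v|)^oo exp (- beta(v) r) / r dr, which dominates
   e^-1 ln (|v| / beta(v)): integrate up to r = 1 / beta(v).  So beta > 0 alpha-almost
   everywhere, and since |v.z| <= |v| |z|, the function
   ln (1 + (v.z / beta(v))^2) is alpha-integrable. *)
Require Import Defs.
From HB Require Import structures.
From mathcomp Require Import all_boot all_order all_algebra.
From mathcomp Require Import all_classical all_reals all_analysis.
From mathcomp Require Import complex measurable_realfun.
From mathcomp Require Import ring lra.

Import Order.TTheory GRing.Theory Num.Theory.
Import numFieldNormedType.Exports.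

Local Open Scope classical_set_scope.
Local Open Scope ring_scope.
Local Open Scope complex_scope.

Set Implicit Arguments.
Unset Strict Implicit.
Unset Printing Implicit Defensive.

(** * Monotonicity and null sets for integrals of arbitrary functions *)

(* The inner integrals of [gamma_exponent] and [gamma_levy] are not known to be
   measurable in v, so the following lemmas avoid any measurability assumption
   on the integrands. *)
Section IntegralNoMeasurability.
Local Open Scope ereal_scope.
Context {d : measure_display} {T : measurableType d} {R : realType}.
Variable mu : {measure set T -> \bar R}.
Import HBNNSimple.

(** The integral of a nonnegative function is a supremum over the simple functions below it, and a
    simple function below [f] extended by [0] outside [A] is also below [g] extended by [0] outside
    [B]. *)
Lemma ge0_subset_le_integral (A B : set T) (f g : T -> \bar R) : A `<=` B ->
  (forall x, A x -> 0 <= f x <= g x) -> (forall x, B x -> 0 <= g x) ->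
  \int[mu]_(x in A) f x <= \int[mu]_(x in B) g x.
Proof.
move=> AB fg g0.
rewrite !ge0_integralE//; last by move=> x /fg /andP[].
apply: le_ereal_sup => _ [h /= hf <-]; exists h => //= x.
apply: (le_trans (hf x)); rewrite !patchE.
case: ifPn => [/set_mem Ax|_]; last first.
  by case: ifPn => // /set_mem /g0.
by rewrite (mem_set (AB _ Ax)); case/andP: (fg _ Ax).
Qed.

(** A simple function below [f] on [D] is measurable, so restricting it to the complement of [Z]
    does not change its integral; the restriction competes in the supremum for [D] minus [Z]. *)
Lemma ge0_integral_setD_null (D Z : set T) (f : T -> \bar R) :
  measurable Z -> mu Z = 0 -> (forall x, D x -> 0 <= f x) ->
  \int[mu]_(x in D) f x = \int[mu]_(x in D `\` Z) f x.
Proof.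
move=> mZ Z0 f0; apply/eqP; rewrite eq_le; apply/andP; split; last first.
  by apply: ge0_subset_le_integral => // x [/f0 ->] /=.
rewrite [leLHS]ge0_integralE//; apply: ge_ereal_sup => _ [h /= hf <-].
rewrite -integralT_nnsfun (ge0_negligible_integral mZ)//=; last 2 first.
- exact/measurable_EFinP.
- by move=> x _; rewrite lee_fin.
rewrite integral_mkcond [leRHS]integral_mkcond.
apply: ge0_subset_le_integral => // x _; last first.
  by apply: erestrict_ge0 => y [/f0].
rewrite erestrict_ge0 => [|y _]; last by rewrite lee_fin.
have := hf x; rewrite !patchE !in_setD in_setT /=.
by case: (x \in D); case: (x \in Z).
Qed.

Lemma integral_setD_null (D Z : set T) (f : T -> \bar R) :
  measurable Z -> mu Z = 0 ->
  \int[mu]_(x in D) f x = \int[mu]_(x in D `\` Z) f x.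
Proof.
move=> mZ Z0; rewrite integralE [RHS]integralE.
by congr (_ - _); apply: ge0_integral_setD_null.
Qed.

End IntegralNoMeasurability.

(** * Borel structure, Euclidean product and norms on [R^d] *)

Lemma continuous_sum (R : realType) (T : topologicalType) (I : finType)
    (F : I -> T -> R) :
  (forall i, continuous (F i)) -> continuous (fun x => \sum_i F i x).
Proof.
move=> cF x; apply: cvg_big => [|i _]; first exact: add_continuous.
exact: cF.
Qed.

Section BorelRd.
Context {R : realType} {d : nat}.
Local Notation V := (borelRd R d).

Lemma continuous_measurable_cV (f : 'cV[R]_d -> R) :
  continuous f -> measurable_fun [set: V] (f : V -> R).
Proof.
move=> cf _; apply: (measurability _ (RGenOpens.measurableE R)) => //.
move=> _ [_ [a [b ->] <-]].
rewrite setTI; apply: sub_sigma_algebra.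
by apply: open_comp => // x _; exact: cf.
Qed.

Lemma coord_cV_continuous (i : 'I_d) : continuous (fun x : 'cV[R]_d => x i 0).
Proof. exact: coord_continuous. Qed.

Lemma dotvE (x y : 'cV[R]_d) : dotv x y = \sum_i x i 0 * y i 0.
Proof. by rewrite /dotv mxE; apply: eq_bigr => i _; rewrite mxE. Qed.

Lemma dotv_ge0 (x : 'cV[R]_d) : 0 <= dotv x x.
Proof. by rewrite dotvE; apply: sumr_ge0 => i _; rewrite -expr2 sqr_ge0. Qed.

Lemma dotv_eq0 (x : 'cV[R]_d) : dotv x x = 0 -> x = 0.
Proof.
rewrite dotvE => /psumr_eq0P h; apply/matrixP => i j.
rewrite ord1 mxE; apply/eqP; rewrite -sqrf_eq0 expr2 h// => k _.
by rewrite -expr2 sqr_ge0.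
Qed.

Lemma dotvZ a (x : 'cV[R]_d) : dotv (a *: x) (a *: x) = a ^+ 2 * dotv x x.
Proof.
by rewrite !dotvE mulr_sumr; apply: eq_bigr => i _; rewrite !mxE; ring.
Qed.

(** For [y != 0] this is the nonnegativity of [|a x - b y|^2 = a (|x|^2 a - b^2)], where [a = |y|^2]
    and [b] is the product of [x] and [y]. *)
Lemma dotv_Cauchy_Schwarz (x y : 'cV[R]_d) :
  dotv x y ^+ 2 <= dotv x x * dotv y y.
Proof.
have [y0|yn0] := eqVneq (dotv y y) 0.
  rewrite (dotv_eq0 y0) !dotvE big1 ?expr0n//=; last first.
    by move=> i _; rewrite mxE mulr0.
  by rewrite [X in _ * X]big1 ?mulr0// => i _; rewrite mxE mulr0.
have yp : 0 < dotv y y by rewrite lt_neqAle eq_sym yn0 dotv_ge0.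
have := dotv_ge0 (dotv y y *: x - dotv x y *: y).
have -> : dotv (dotv y y *: x - dotv x y *: y) (dotv y y *: x - dotv x y *: y) =
   dotv y y * (dotv x x * dotv y y - dotv x y ^+ 2).
  set a := dotv y y; set b := dotv x y.
  (* With [a] and [b] kept as scalars, this equality holds coordinate by coordinate; only then are
     the products folded back into [a] and [b]. *)
  transitivity (a ^+ 2 * dotv x x - 2 * a * b * dotv x y + b ^+ 2 * dotv y y).
    rewrite !dotvE !mulr_sumr -sumrB -big_split /=.
    by apply: eq_bigr => i _; rewrite !mxE; ring.
  by rewrite -/a -/b; ring.
by rewrite pmulr_rge0// subr_ge0.
Qed.

Lemma continuous_dotvr (z : 'cV[R]_d) : continuous (fun x => dotv x z).
Proof.
under eq_fun do rewrite dotvE.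
apply: continuous_sum => i x.
by apply: continuousM; [exact: coord_cV_continuous|exact: cst_continuous].
Qed.

Lemma continuous_dotv_diag : continuous (fun x : 'cV[R]_d => dotv x x).
Proof.
under eq_fun do rewrite dotvE.
by apply: continuous_sum => i x; apply: continuousM; exact: coord_cV_continuous.
Qed.

Variable N : 'cV[R]_d -> R.
Hypothesis normN : is_norm N.

Lemma is_norm0 : N 0 = 0.
Proof. by rewrite -(scale0r 0) (norm_homogeneous normN) normr0 mul0r. Qed.

Lemma is_normN x : N (- x) = N x.
Proof. by rewrite -scaleN1r (norm_homogeneous normN) normrN1 mul1r. Qed.

Lemma is_norm_le_coord x : N x <= \sum_i `|x i 0| * N (delta_mx i 0).
Proof.
rewrite {1}[x]matrix_sum_delta; under eq_bigr do rewrite big_ord1.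
elim/big_ind2 : _ => [|a b c e h k|i _].
- by rewrite is_norm0.
- exact: le_trans (norm_triangle normN _ _) (lerD h k).
- by rewrite (norm_homogeneous normN).
Qed.

Lemma is_norm_dist x y : `|N x - N y| <= N (x - y).
Proof.
have h a b : N a - N b <= N (a - b).
  by rewrite lerBlDr -{1}(subrK b a); exact: norm_triangle.
by rewrite ler_norml h andbT lerNl opprB (le_trans (h _ _))// -is_normN opprB.
Qed.

(** The topology on columns comes from the coordinates, not from [N]. By the reverse triangle
    inequality, [|N x - N y|] is at most [F y], and [F] is continuous and vanishes at [x].
    Continuity makes the unit sphere Borel. *)
Lemma is_norm_continuous : continuous N.
Proof.
move=> x; pose F (y : 'cV[R]_d) := \sum_i `|y i 0 - x i 0| * N (delta_mx i 0).
have Fx0 : F x = 0 by rewrite /F big1// => i _; rewrite subrr normr0 mul0r.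
have cF : continuous F.
  apply: continuous_sum => i y.
  have cxi : continuous (fun y : 'cV[R]_d => y i 0 - x i 0).
    move=> w; apply: continuousB; last exact: cst_continuous.
    exact: coord_cV_continuous.
  have cn : continuous (fun y : 'cV[R]_d => `|y i 0 - x i 0| : R).
    by move=> w; exact: (cvg_norm (cxi w)).
  by apply: (continuousM (cn y)); exact: cst_continuous.
have := cF x; rewrite /continuous_at Fx0 => F0.
apply/(@cvgrPdist_le _ _ _ (nbhs x) (nbhs_filter x)) => e e0.
move/(@cvgrPdist_le _ _ _ (nbhs x) (nbhs_filter x)) : F0 => /(_ _ e0).
apply: filterS => y; rewrite sub0r normrN => h.
rewrite distrC (le_trans (is_norm_dist _ _))//.
rewrite (le_trans (is_norm_le_coord _))//.
under eq_bigr do rewrite mxE [X in _ + X]mxE; exact: le_trans (ler_norm _) h.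
Qed.

Lemma measurable_unit_sphere : measurable (unit_sphere N).
Proof.
have -> : unit_sphere N = [set: V] `&` (N : V -> R) @^-1` [set 1].
  by rewrite setTI.
exact: (continuous_measurable_cV is_norm_continuous).
Qed.

Lemma unit_sphere_dotv_gt0 v : unit_sphere N v -> 0 < dotv v v.
Proof.
move=> Nv; rewrite lt_neqAle dotv_ge0 andbT eq_sym; apply/eqP => /dotv_eq0 v0.
by move: Nv; rewrite /unit_sphere /= v0 is_norm0 => /esym/eqP; rewrite oner_eq0.
Qed.

End BorelRd.

(** * Laplace transforms of [cos] and [sin] *)

Section LaplaceTrig.
Context {R : realType}.
Notation leb := (@lebesgue_measure R).
Implicit Types b s r t : R.

Lemma continuous_compMl (g : R -> R) s : continuous g ->
  continuous (fun r : R => g (s * r)).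
Proof.
move=> cg r; have cs : {for r, continuous (fun r : R => s * r)}.
  by apply: continuousM; [exact: cst_continuous|exact: cvg_id].
exact: (continuous_comp cs (cg _)).
Qed.

Lemma continuous_expRMl b : continuous (fun r : R => expR (- b * r)).
Proof. apply: continuous_compMl; exact: continuous_expR. Qed.

Lemma cvgy_expRMl b : 0 < b -> expR (- b * r) @[r --> +oo] --> (0 : R).
Proof.
move=> b0.
rewrite (_ : (fun r => _) = (fun z => expR (- z)) \o (fun z => b * z)).
  apply: (@cvg_comp _ _ _ _ _ _ (pinfty_nbhs R)); last exact: cvgr_expR.
  exact: gt0_cvgMry.
by apply/funext => r /=; rewrite mulNr.
Qed.

(** For [b > 0], the antiderivative of [(A + B cos (s r) + C sin (s r)) exp (- b r)] that tends to
    [0] at infinity: the integral over the half-line is minus its value at [0]. *)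
Let prim b s (A B C : R) (r : R) :=
  - expR (- b * r) * (A / b + (B * b + C * s) / (b ^+ 2 + s ^+ 2) * cos (s * r)
    + (C * b - B * s) / (b ^+ 2 + s ^+ 2) * sin (s * r)).

Let is_derive_prim b s A B C r : 0 < b ->
  is_derive r 1 (prim b s A B C)
   ((A + B * cos (s * r) + C * sin (s * r)) * expR (- b * r)).
Proof.
move=> b0; have lin (a : R) : is_derive r 1 (fun r => a * r) a.
  by apply: is_derive_eq; rewrite /GRing.scale/= mulr1.
have E : is_derive r 1 (fun r => expR (- b * r)) (expR (- b * r) * - b).
  exact: (@is_derive1_comp _ expR (fun r => - b * r)).
have Cs : is_derive r 1 (fun r => cos (s * r)) (- sin (s * r) * s).
  exact: (@is_derive1_comp _ cos (fun r => s * r)).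
have Sn : is_derive r 1 (fun r => sin (s * r)) (cos (s * r) * s).
  exact: (@is_derive1_comp _ sin (fun r => s * r)).
rewrite /prim; apply: is_derive_eq; rewrite /GRing.scale/=.
have bs0 : b ^+ 2 + s ^+ 2 != 0.
  by rewrite gt_eqF// ltr_pwDl ?sqr_ge0 ?exprn_gt0.
by field; rewrite bs0 gt_eqF.
Qed.

Let cvgy_prim b s A B C : 0 < b -> prim b s A B C r @[r --> +oo] --> (0 : R).
Proof.
move=> b0.
set K := `|A / b| + `|(B * b + C * s) / (b ^+ 2 + s ^+ 2)| +
  `|(C * b - B * s) / (b ^+ 2 + s ^+ 2)|.
apply/cvgr0Pnorm_le => e e0.
(* [K] is [0] when [A = B = C = 0], so the tolerance is divided by [K + 1]. *)
have K0 : 0 < K + 1 by rewrite ltr_wpDl// !addr_ge0.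
have /cvgr0Pnorm_le/(_ (e / (K + 1))) := cvgy_expRMl b0.
rewrite divr_gt0// => /(_ isT).
apply: filterS => r; rewrite ler_pdivlMr// => h; apply: (le_trans _ h).
rewrite /prim normrM normrN ler_wpM2l//.
apply: (@le_trans _ _ K); last by rewrite lerDl.
rewrite (le_trans (ler_normD _ _))// lerD//.
  rewrite (le_trans (ler_normD _ _))// lerD// normrM ler_piMr//.
  by rewrite ler_norml cos_geN1 cos_le1.
by rewrite normrM ler_piMr// ler_norml sin_geN1 sin_le1.
Qed.

(* The nonnegativity required by FTC2y is met below by adding the constant 1 to
   cos or sin; the integral of exp (- b r) is then subtracted. *)
Let integral_trig_expR b s A B C : 0 < b ->
  (forall r, 0 <= A + B * cos (s * r) + C * sin (s * r)) ->
  (\int[leb]_(r in `[0%R, +oo[)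
     ((A + B * cos (s * r) + C * sin (s * r)) * expR (- b * r))%:E =
   (A / b + (B * b + C * s) / (b ^+ 2 + s ^+ 2))%:E)%E.
Proof.
move=> b0 ge0; have dp r := is_derive_prim s A B C r b0.
have cf : continuous
    (fun r : R => (A + B * cos (s * r) + C * sin (s * r)) * expR (- b * r)).
  move=> r; have k (a : R) : {for r, continuous (fun=> a)}.
    exact: cst_continuous.
  have cc := continuousM (k B) (@continuous_compMl _ s (@continuous_cos R) r).
  have cs := continuousM (k C) (@continuous_compMl _ s (@continuous_sin R) r).
  exact: (continuousM (continuousD (continuousD (k A) cc) cs)
    (@continuous_expRMl b r)).
rewrite (@ge0_continuous_FTC2y _ _ (prim b s A B C) _ 0).
- rewrite /prim !mulr0 expR0 cos0 sin0 !mulr1 mulr0 addr0 mulN1r EFinN.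
  by rewrite oppeK add0e.
- by move=> r _; rewrite mulr_ge0// expR_ge0.
- exact: continuous_subspaceT.
- exact: cvgy_prim.
- by move=> r _; have := dp r => -[].
- apply/cvg_at_right_filter/differentiable_continuous/derivable1_diffP.
  by have := dp 0 => -[].
- by move=> r _; rewrite derive1E; apply: derive_val.
Qed.

Lemma measurable_expRMl b D : measurable D ->
  measurable_fun D (fun r : R => expR (- b * r)).
Proof.
move=> mD; apply: measurable_funTS; apply: continuous_measurable_fun.
exact: continuous_expRMl.
Qed.

Lemma integrable_expRMl b : 0 < b ->
  leb.-integrable `[0%R, +oo[ (EFin \o (fun r => expR (- b * r))).
Proof.
move=> b0; apply/integrableP; split.
  by apply/measurable_EFinP; exact: measurable_expRMl.
under eq_integral => r _ do rewrite /= ger0_norm ?expR_ge0//.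
(* The constant [1] is the case [A = 1], [B = C = s = 0] of the trigonometric formula. *)
have h (r : R) : 0 <= 1 + 0 * cos (0 * r) + 0 * sin (0 * r) :> R.
  by rewrite !mul0r !addr0.
suff -> : (\int[leb]_(r in `[0%R, +oo[) (expR (- b * r))%:E =
    (1 / b + (0 * b + 0 * 0) / (b ^+ 2 + 0 ^+ 2))%:E)%E by rewrite ltry.
rewrite -(integral_trig_expR b0 h); apply: eq_integral => r _.
by rewrite !mul0r !addr0 mul1r.
Qed.

Lemma measurable_compMl (g : R -> R) s D : continuous g -> measurable D ->
  measurable_fun D (fun r => g (s * r)).
Proof.
move=> cg mD; apply: measurable_funTS; apply: continuous_measurable_fun => r.
exact: continuous_compMl.
Qed.

Lemma integrable_bounded_expR (g : R -> R) b : 0 < b ->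
  measurable_fun (`[0, +oo[%classic : set R) g -> (forall r, `|g r| <= 1) ->
  leb.-integrable `[0%R, +oo[ (EFin \o (fun r => g r * expR (- b * r))).
Proof.
move=> b0 mg g1; apply: (le_integrable _ _ _ (integrable_expRMl b0)) => //.
  by apply/measurable_EFinP; apply: measurable_funM => //;
    exact: measurable_expRMl.
move=> r _; rewrite /= lee_fin normrM ler_piMl//.
Qed.

Lemma integrable_cos_expR b s : 0 < b -> leb.-integrable `[0%R, +oo[
  (EFin \o (fun r => cos (s * r) * expR (- b * r))).
Proof.
move=> b0; apply: integrable_bounded_expR => //.
  by apply: measurable_compMl => //; exact: continuous_cos.
by move=> r; rewrite ler_norml cos_geN1 cos_le1.
Qed.

Lemma integrable_sin_expR b s : 0 < b -> leb.-integrable `[0%R, +oo[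
  (EFin \o (fun r => sin (s * r) * expR (- b * r))).
Proof.
move=> b0; apply: integrable_bounded_expR => //.
  by apply: measurable_compMl => //; exact: continuous_sin.
by move=> r; rewrite ler_norml sin_geN1 sin_le1.
Qed.

Lemma Rintegral_expRMl b : 0 < b ->
  \int[leb]_(r in `[0, +oo[) expR (- b * r) = b^-1.
Proof.
move=> b0; have h (r : R) : 0 <= 1 + 0 * cos (0 * r) + 0 * sin (0 * r) :> R.
  by rewrite !mul0r !addr0.
have := integral_trig_expR b0 h; rewrite !mul0r !addr0 !mul0r addr0 div1r.
rewrite /Rintegral => H; move: (congr1 fine H) => /= <-; congr fine.
apply: eq_integral => r _.
by rewrite !mul0r !addr0 mul1r.
Qed.

Lemma Rintegral_cos_expR b s : 0 < b ->
  \int[leb]_(r in `[0, +oo[) (cos (s * r) * expR (- b * r)) =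
  b / (b ^+ 2 + s ^+ 2).
Proof.
move=> b0; have h (r : R) : 0 <= 1 + 1 * cos (s * r) + 0 * sin (s * r) :> R.
  by rewrite mul0r addr0 mul1r -lerBlDl sub0r cos_geN1.
have := integral_trig_expR b0 h; rewrite !mul1r !mul0r !addr0 => H.
apply: (addrI b^-1); rewrite -{1}(Rintegral_expRMl b0) -RintegralD//.
- rewrite /Rintegral; move: (congr1 fine H) => /= <-; congr fine.
  by apply: eq_integral => r _; congr EFin; ring.
- exact: integrable_expRMl.
- exact: integrable_cos_expR.
Qed.

Lemma Rintegral_sin_expR b s : 0 < b ->
  \int[leb]_(r in `[0, +oo[) (sin (s * r) * expR (- b * r)) =
  s / (b ^+ 2 + s ^+ 2).
Proof.
move=> b0; have h (r : R) : 0 <= 1 + 0 * cos (s * r) + 1 * sin (s * r) :> R.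
  by rewrite mul0r addr0 mul1r -lerBlDl sub0r sin_geN1.
have := integral_trig_expR b0 h; rewrite !mul1r !mul0r ?add0r => H.
apply: (addrI b^-1); rewrite -{1}(Rintegral_expRMl b0) -RintegralD//.
- rewrite /Rintegral; move: (congr1 fine H) => /= <-; congr fine.
  by apply: eq_integral => r _; congr EFin; ring.
- exact: integrable_expRMl.
- exact: integrable_sin_expR.
Qed.

(** Inversion is continuous on the open complement of [0], and every function is measurable on a
    singleton. *)
Lemma measurable_invr : measurable_fun [set: R] (@GRing.inv R).
Proof.
rewrite -(setUv [set 0 : R]); apply/measurable_funU => //.
  exact: measurableC.
split; first exact: measurable_fun_set1.
apply: open_continuous_measurable_fun.
  by rewrite openC; exact: closed_eq.
by move=> x; rewrite inE/= => /eqP x0; exact: inv_continuous.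
Qed.

End LaplaceTrig.

(** * Differentiation under the integral sign, for [g] equal to [sin] or to [cos - 1] *)

Section FrullaniTrig.
Context {R : realType}.
Notation leb := (@lebesgue_measure R).

(** Mean value theorem between [0] and [x]. The resulting bound [|g (t r)| <= |t| r] compensates the
    singularity of [1 / r] at [0]. *)
Lemma norm_le_of_derive_norm_le1 (g dg : R -> R) :
  (forall x : R, is_derive x 1 g (dg x)) ->
  (forall x, `|dg x| <= 1) -> g 0 = 0 -> forall x, `|g x| <= `|x|.
Proof.
move=> dg_ dg1 g0 x.
have cg : continuous g.
  move=> y; apply/differentiable_continuous/derivable1_diffP.
  by have := dg_ y => -[].
have [x0|x0|->] := ltgtP x 0; last by rewrite g0.
- have [c _] := MVT x0 (fun y _ => dg_ y) (continuous_subspaceT cg).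
  rewrite g0 !sub0r => /(congr1 Num.norm); rewrite normrN normrM normrN => ->.
  by rewrite ler_piMl.
- have [c _] := MVT x0 (fun y _ => dg_ y) (continuous_subspaceT cg).
  rewrite g0 !subr0 => /(congr1 Num.norm); rewrite normrM => ->.
  by rewrite ler_piMl.
Qed.

Variables (g dg : R -> R) (b : R).
Hypotheses (dgE : forall x : R, is_derive x 1 g (dg x)) (cdg : continuous dg).
Hypotheses (dg1 : forall x, `|dg x| <= 1) (g0 : g 0 = 0) (b0 : 0 < b).

Let D : set R := `]0, +oo[.
Let mD : measurable D := measurable_itv _.

Let cg : continuous g.
Proof.
move=> y; apply/differentiable_continuous/derivable1_diffP.
by have := dgE y => -[].
Qed.

Lemma measurable_frullani (A : set R) t : measurable A ->
  measurable_fun A (fun r => g (t * r) * (expR (- b * r) / r)).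
Proof.
move=> mA; apply: measurable_funM; first exact: measurable_compMl.
apply: measurable_funM; first exact: measurable_expRMl.
by apply: measurable_funTS; exact: measurable_invr.
Qed.

Lemma integrable_frullani t : leb.-integrable (`[0%R, +oo[)
  (EFin \o (fun r => g (t * r) * (expR (- b * r) / r))).
Proof.
have : leb.-integrable `[0%R, +oo[ (EFin \o (fun r => `|t| * expR (- b * r))).
  rewrite (_ : _ \o _ = (fun r => `|t|%:E * (expR (- b * r))%:E)%E)//.
  by apply: integrableZl => //; exact: integrable_expRMl.
move=> h; apply: (le_integrable _ _ _ h) => //.
  by apply/measurable_EFinP; exact: measurable_frullani.
move=> r /=; rewrite in_itv/= andbT => r0; rewrite lee_fin.
rewrite 3!normrM normfV (ger0_norm (expR_ge0 _)) normr_id mulrCA mulrC.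
rewrite ler_wpM2r ?expR_ge0//.
(* At [r = 0] the convention [0^-1 = 0] makes the integrand vanish. *)
have [->|rn0] := eqVneq r 0; first by rewrite normr0 invr0 mulr0.
rewrite ler_pdivrMr ?normr_gt0// -normrM.
exact: norm_le_of_derive_norm_le1.
Qed.

Let F t := \int[leb]_(r in `[0, +oo[) (g (t * r) * (expR (- b * r) / r)).

(** For [r > 0], differentiating in [t] produces a factor [r] that cancels [1 / r], and what remains
    is bounded by [exp (- b r)] uniformly in [t]. *)
Lemma is_derive_frullani (t : R) : is_derive t 1 F
  (\int[leb]_(r in `[0, +oo[) (dg (t * r) * expR (- b * r))).
Proof.
pose f (t r : R) := g (t * r) * (expR (- b * r) / r).
(* At [r = 0] the integrand is constantly [0] in [t], so its derivative would be [0] and not [dg 0];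
   hence the passage to the open half-line. *)
have FE : F = fun t => \int[leb]_(r in D) f t r.
  apply/funext => x; rewrite /F -Rintegral_itv_obnd_cbnd//.
  by apply: integrableS (integrable_frullani x) => //;
    apply: subset_itvr; rewrite bnd_simp.
have df (x r : R) : D r -> is_derive x 1 (f ^~ r) (dg (x * r) * expR (- b * r)).
  rewrite /D/= in_itv/= andbT => r0.
  have h : is_derive x 1 (fun x => g (x * r)) (dg (x * r) * r).
    apply: (@is_derive1_comp _ g (fun x => x * r)).
    by apply: is_derive_eq; rewrite /GRing.scale/= ?mulr0 ?addr0 ?add0r mulr1.
  rewrite /f; apply: is_derive_eq; rewrite /GRing.scale/=.
  by rewrite mulr0 add0r; field; rewrite gt_eqF.
have p1 (x r : R) : D r -> partial1of2 f x r = dg (x * r) * expR (- b * r).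
  by move=> Dr; rewrite partial1of2E; apply: derive_val; exact: df.
(* The dominating function does not depend on [t]: the radius [1] is arbitrary. *)
have tI : `]t - 1, t + 1[%classic t.
  by rewrite /= in_itv/= ltrBlDr ltrDl ltr01.
have intf x : `]t - 1, t + 1[%classic x -> leb.-integrable D (EFin \o f x).
  by move=> _; apply: integrableS (integrable_frullani x) => //;
    apply: subset_itvr; rewrite bnd_simp.
have derf x r : `]t - 1, t + 1[%classic x -> D r -> derivable (f ^~ r) x 1.
  by move=> _ Dr; have := df x r Dr => -[].
have iG : leb.-integrable D (EFin \o (fun r => expR (- b * r))).
  by apply: integrableS (integrable_expRMl b0) => //;
    apply: subset_itvr; rewrite bnd_simp.
have G0 (r : R) : 0 <= expR (- b * r) by exact: expR_ge0.
have Gub x r : `]t - 1, t + 1[%classic x -> D r ->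
    `|partial1of2 f x r| <= expR (- b * r).
  by move=> _ Dr; rewrite p1// normrM (ger0_norm (expR_ge0 _)) ler_piMl.
rewrite FE; apply: DeriveDef.
  exact: (@derivable_under_integral _ _ _ leb f D mD _ _ _ tI intf derf
    _ G0 iG Gub).
rewrite -derive1E.
rewrite (@differentiation_under_integral _ _ _ leb f D mD _ _ _ tI intf derf
  _ G0 iG Gub).
rewrite -Rintegral_itv_obnd_cbnd; last first.
  have /integrableS : leb.-integrable `[0%R, +oo[
      (EFin \o (fun r => dg (t * r) * expR (- b * r))).
    by apply: integrable_bounded_expR => //; exact: measurable_compMl.
  by apply => //; apply: subset_itvr; rewrite bnd_simp.
by apply: eq_Rintegral => r; rewrite inE => Dr; rewrite p1.
Qed.

End FrullaniTrig.

(** * Closed forms of the two oscillatory integrals *)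

Section FrullaniLog.
Context {R : realType}.
Notation leb := (@lebesgue_measure R).
Variable b : R.
Hypothesis b0 : 0 < b.

Lemma is_derive_cosB1 (x : R) : is_derive x 1 (fun x => cos x - 1) (- sin x).
Proof. by apply: is_derive_eq; rewrite subr0. Qed.

Lemma eq_is_derive (F G df : R -> R) : (forall x : R, is_derive x 1 F (df x)) ->
  (forall x : R, is_derive x 1 G (df x)) -> F 0 = G 0 -> forall x, F x = G x.
Proof.
move=> dF dG FG x; apply/eqP; rewrite -subr_eq0; apply/eqP.
have -> : 0 = F 0 - G 0 by rewrite FG subrr.
apply: (@is_derive_0_is_cst _ (fun x => F x - G x)) => y.
by apply: is_derive_eq; rewrite subrr.
Qed.

Lemma Rintegral_sin_frullani t :
  \int[leb]_(r in `[0, +oo[) (sin (t * r) * (expR (- b * r) / r)) =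
  atan (t / b).
Proof.
move: t; apply: (@eq_is_derive _ _ (fun t => b / (b ^+ 2 + t ^+ 2))).
- move=> t; rewrite -Rintegral_cos_expR//.
  apply: is_derive_frullani => //; first exact: continuous_cos.
  + by move=> x; rewrite ler_norml cos_geN1 cos_le1.
  + exact: sin0.
- move=> t.
  have h : is_derive t 1 (fun t => t / b) b^-1.
    by apply: is_derive_eq; rewrite /GRing.scale/= mulr1 ?mulr0 ?add0r ?addr0.
  have -> : b / (b ^+ 2 + t ^+ 2) = (1 + (t / b) ^+ 2)^-1 * b^-1.
    by field; rewrite !gt_eqF//= ltr_pwDl ?sqr_ge0 ?exprn_gt0.
  exact: is_derive1_comp.
- rewrite mul0r atan0 /Rintegral integral0_eq// => r _.
  by rewrite mul0r sin0 mul0r.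
Qed.

Lemma Rintegral_cos_frullani t :
  \int[leb]_(r in `[0, +oo[) ((cos (t * r) - 1) * (expR (- b * r) / r)) =
  - (ln (1 + (t / b) ^+ 2) / 2).
Proof.
move: t; apply: (@eq_is_derive _ _ (fun t => - (t / (b ^+ 2 + t ^+ 2)))).
- move=> t.
  have <- : \int[leb]_(r in `[0, +oo[) (- sin (t * r) * expR (- b * r)) =
      - (t / (b ^+ 2 + t ^+ 2)).
    rewrite -Rintegral_sin_expR// -[RHS]mulN1r -RintegralZl//.
      by apply: eq_Rintegral => r _; ring.
    exact: integrable_sin_expR.
  apply: (is_derive_frullani is_derive_cosB1) => //.
  + by move=> x; apply: continuousN; exact: continuous_sin.
  + by move=> x; rewrite normrN ler_norml sin_geN1 sin_le1.
  + by rewrite cos0 subrr.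
- move=> t.
  have p : 0 < 1 + (t / b) ^+ 2 by rewrite ltr_pwDl ?sqr_ge0.
  have h : is_derive t 1 (fun t => 1 + (t / b) ^+ 2) (2 * (t / b) * b^-1).
    by apply: is_derive_eq; rewrite /GRing.scale/=; ring.
  have h2 := @is_derive1_comp _ (@ln R) (fun t => 1 + (t / b) ^+ 2) t _ _
    (is_derive1_ln p) h.
  have -> : - (t / (b ^+ 2 + t ^+ 2)) =
      - ((1 + (t / b) ^+ 2)^-1 * (2 * (t / b) * b^-1) / 2).
    by field; rewrite !gt_eqF//= ltr_pwDl ?sqr_ge0 ?exprn_gt0.
  apply: is_deriveN; apply: is_derive_eq.
  by rewrite /GRing.scale/=; ring.
- rewrite mul0r expr0n/= addr0 ln1 mul0r oppr0 /Rintegral integral0_eq// => r _.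
  by rewrite mul0r cos0 subrr mul0r.
Qed.

End FrullaniLog.

(** * Real and imaginary parts of the logarithm *)

Section ClnGamma.
Context {R : realType}.

Lemma exp_imag (x : R) : cexp ('i * x%:C) = cos x +i* sin x.
Proof.
rewrite /cexp /= /real_complex_def; simpc.
by rewrite expR0 !mul1r.
Qed.

(** With [u = t / b] the quotient is [1 / (1 - i u) = (1 + i u) / (1 + u^2)], of modulus
    [(1 + u^2)^(-1/2)] and, its real part being positive, of argument [atan u]. *)
Lemma cln_gamma (b t : R) : 0 < b ->
  cln (b%:C / (b%:C - 'i * t%:C)) =
  - (ln (1 + (t / b) ^+ 2) / 2) +i* atan (t / b).
Proof.
move=> b0; pose u := t / b; pose c := 1 + u ^+ 2.
have c0 : 0 < c by rewrite ltr_pwDl ?sqr_ge0.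
have -> : b%:C / (b%:C - 'i * t%:C) = c^-1 +i* (u / c).
  have h : b ^+ 2 + t ^+ 2 != 0.
    by rewrite gt_eqF// ltr_pwDl ?sqr_ge0 ?exprn_gt0.
  have E : b%:C - 'i * t%:C = b +i* (- t) by rewrite /real_complex_def; simpc.
  rewrite E; apply: (@mulIf _ (b +i* (- t))).
    by rewrite eq_complex /= gt_eqF.
  rewrite divfK; last by rewrite eq_complex /= gt_eqF.
  rewrite /real_complex_def; simpc; rewrite /c /u.
  by congr (_ +i* _); field; rewrite gt_eqF//= h.
have mE : cmod (c^-1 +i* (u / c)) = (Num.sqrt c)^-1.
  rewrite /cmod /= -sqrtrV ?ltW//; congr Num.sqrt.
  by rewrite /c; field; rewrite -/c gt_eqF.
have s0 : 0 < Num.sqrt c by rewrite sqrtr_gt0.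
rewrite /cln mE /carg mE /= lnV ?posrE//; congr (_ +i* _).
  have sc : ln c = ln (Num.sqrt c) * 2.
    rewrite -{1}(sqr_sqrtr (ltW c0)) expr2 lnM ?posrE//.
    by rewrite mulr_natr mulr2n.
  by rewrite /= -/u -/c sc mulfK.
have -> : c^-1 / (Num.sqrt c)^-1 = cos (atan u).
  rewrite cos_atan -/c invrK -{1}(sqr_sqrtr (ltW c0)).
  by field; rewrite gt_eqF.
have hp := atan_ltpi2 u; have hn := atan_gtNpi2 u; have p0 := pi_gt0 R.
(* The imaginary part has the sign of [u], hence of [atan u]. Since [acos (cos x) = |x|] for
   [|x| <= pi], both branches of [carg] give [atan u]. *)
rewrite pmulr_lge0 ?invr_gt0//; case: ifPn => [u0|]; rewrite -/u.
  have a0 : 0 <= atan u by rewrite -(@atan0 R) le_atan.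
  by rewrite cosK// in_itv/= a0/=; lra.
rewrite -ltNge => /ltW u0.
have a0 : atan u <= 0 by rewrite -(@atan0 R) le_atan.
by rewrite cosKN ?opprK// a0 andbT; lra.
Qed.

(* Junk values at beta = 0, an alpha-null case. *)
Lemma cln_gamma0 (t : R) :
  cln ((0 : R)%:C / ((0 : R)%:C - 'i * t%:C)) = ln 0 +i* acos 0.
Proof.
rewrite mul0r /cln /carg /cmod /= lexx expr0n/= addr0.
by rewrite sqrtr0 mul0r.
Qed.

Lemma Re_cexpB1_mul (x k : R) :
  complex.Re ((cexp ('i * x%:C) - 1) * k%:C) = (cos x - 1) * k.
Proof. by rewrite exp_imag /real_complex_def; simpc. Qed.

Lemma Im_cexpB1_mul (x k : R) :
  complex.Im ((cexp ('i * x%:C) - 1) * k%:C) = sin x * k.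
Proof. by rewrite exp_imag /real_complex_def; simpc. Qed.

End ClnGamma.

(** * A logarithmic lower bound for the radial integral *)

Section LowerBound.
Context {R : realType}.
Notation leb := (@lebesgue_measure R).

(** On [[1 / w, 1 / b]] one has [h r = 1] and [k r <= b r <= 1], so the integrand is at least
    [e^-1 / r]. Keeping [b] apart from the rate [k] allows [k = 0], where [b] can be taken
    arbitrarily small. *)
Lemma ge_integral_expR_over_r (h : R -> R) (k b w : R) :
  (forall r, 0 <= h r) -> (forall r, w^-1 <= r -> h r = 1) ->
  0 < w -> 0 < b -> k <= b ->
  ((expR (- 1) * ln (w / b))%:E <=
   \int[leb]_(r in `[0%R, +oo[) (h r * (expR (- k * r) / r))%:E)%E.
Proof.
move=> h0 h1 w0 b0 kb.
have ge0 r : `[0%R, +oo[%classic r -> (0 <= (h r * (expR (- k * r) / r))%:E)%E.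
  rewrite /= in_itv/= andbT => r0.
  by rewrite lee_fin mulr_ge0// divr_ge0// expR_ge0.
(* For [w <= b] the interval degenerates, but then the logarithm is nonpositive. *)
have [wb|bw] := leP w b.
  apply: (@le_trans _ _ 0%E); last exact: integral_ge0.
  rewrite lee_fin mulr_ge0_le0 ?expR_ge0// ln_le0//.
  by rewrite ler_pdivrMr// mul1r.
have bw' : w^-1 < b^-1 by rewrite ltf_pV2.
have w'0 : 0 < w^-1 by rewrite invr_gt0.
have dF (r : R) : 0 < r ->
    is_derive r 1 (fun r => expR (- 1) * ln r) (expR (- 1) / r).
  move=> r0; have h' := is_derive1_ln r0.
  by apply: is_derive_eq; rewrite /GRing.scale/= ?mulr0 ?addr0.
have cF (r : R) : 0 < r -> {for r, continuous (fun r => expR (- 1) * ln r)}.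
  move=> r0; apply/differentiable_continuous/derivable1_diffP.
  by have := dF r r0 => -[].
have -> : ((expR (- 1) * ln (w / b))%:E =
    \int[leb]_(r in `[(w^-1)%R, (b^-1)%R]) (expR (- 1) / r)%:E)%E.
  rewrite (@continuous_FTC2 _ _ (fun r => expR (- 1) * ln r))//.
  - rewrite -EFinB -mulrBr ln_div ?posrE// !lnV ?posrE//.
    by congr (_ * _)%:E; ring.
  - apply: continuous_in_subspaceT => r.
    rewrite inE/= in_itv/= => /andP[wr _].
    have r0 : r != 0 by rewrite gt_eqF// (lt_le_trans w'0).
    have k1 : {for r, continuous (fun=> expR (- 1) : R)}.
      exact: cst_continuous.
    exact: (continuousM k1 (inv_continuous r0)).
  - split.
    + move=> r; rewrite in_itv/= => /andP[wr _].
      by have := dF r (lt_trans w'0 wr) => -[].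
    + by apply/cvg_at_right_filter; exact: cF.
    + by apply/cvg_at_left_filter; apply: cF; rewrite invr_gt0.
  - move=> r; rewrite in_itv/= => /andP[wr _].
    by rewrite derive1E; apply: derive_val; apply: dF; exact: lt_trans wr.
apply: ge0_subset_le_integral => //.
  apply: subset_itv; rewrite bnd_simp//; exact: ltW.
move=> r /=; rewrite in_itv/= => /andP[wr rb].
have r0 : 0 < r by exact: lt_le_trans wr.
rewrite !lee_fin divr_ge0 ?expR_ge0 ?(ltW r0)//= h1// mul1r.
rewrite ler_wpM2r ?invr_ge0 ?(ltW r0)// ler_expR mulNr lerN2.
apply: (@le_trans _ _ (b * r)); first by rewrite ler_wpM2r// ltW.
by rewrite -ler_pdivlMl// mulr1.
Qed.

End LowerBound.

(** * Integrability over the sphere from the Levy condition *)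

Section GammaLevy.
Context {R : realType} {d : nat}.
Local Notation V := (borelRd R d).
Variables (N : 'cV[R]_d -> R) (normN : is_norm N).
Variables (alpha : {finite_measure set V -> \bar R}) (beta : V -> R).
Let S := unit_sphere N.
Hypothesis beta_ge0 : forall v, S v -> 0 <= beta v.
Hypothesis mbeta : measurable_fun S beta.
Hypothesis levy : exists nu : {measure set V -> \bar R},
    (forall E, measurable E -> nu E = gamma_levy N alpha beta E) /\
    levy_measure nu.

Let mS : measurable S := measurable_unit_sphere normN.

Let E : set V := [set x | 1 <= dotv x x].

(* e^-1 ln (|v| / beta v), truncated below at 0, and its limit at beta v = 0. *)
Let g (v : V) : \bar R := if beta v == 0 then +oo%E else
  (expR (- 1) * (ln (Num.max 1 (dotv v v / beta v ^+ 2)) / 2))%:E.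

Let mdotv : measurable_fun [set: V] (fun v : V => dotv v v).
Proof. exact: continuous_measurable_cV (@continuous_dotv_diag R d). Qed.

Let g_ge0 v : (0 <= g v)%E.
Proof.
rewrite /g; case: ifP => // _; rewrite lee_fin mulr_ge0 ?expR_ge0//.
by rewrite divr_ge0// ln_ge0// le_max lexx.
Qed.

Lemma measurable_fun_beta_eq0 : measurable_fun S (fun v => beta v == 0).
Proof. by apply: measurable_fun_eqr => //; exact: measurable_cst. Qed.

Let mg : measurable_fun S g.
Proof.
apply: measurable_fun_if => //; first exact: measurable_fun_beta_eq0.
apply/measurable_EFinP; apply: measurable_funM => //.
apply: measurable_funM => //.
apply: (measurableT_comp (@measurable_ln R)).
apply: measurable_maxr => //; apply: measurable_funM.
  exact: measurable_funTS.
apply: (measurableT_comp (@measurable_invr R)).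
apply: measurable_funX; apply: measurable_funS mbeta => //.
Qed.

(** With [w] the Euclidean length of [v], the point [r v] lies in [E] once [r >= 1 / w], so the
    logarithmic lower bound applies: with [b = beta v] if this is positive, with all small [b]
    otherwise. *)
Let g_le v : S v -> (g v <= \int[lebesgue_measure]_(r in `[0%R, +oo[)
  (\1_E (r *: (v : 'cV[R]_d)) * (expR (- beta v * r) / r))%R%:E)%E.
Proof.
move=> Sv; have q0 := unit_sphere_dotv_gt0 normN Sv.
have b0 := beta_ge0 Sv.
pose w := Num.sqrt (dotv v v); have w0 : 0 < w by rewrite sqrtr_gt0.
have w2 : w ^+ 2 = dotv v v by rewrite sqr_sqrtr// ltW.
pose h r := \1_E (r *: (v : 'cV[R]_d)) : R.
have h0 r : 0 <= h r by [].
have h1 r : w^-1 <= r -> h r = 1.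
  move=> wr; rewrite /h indicE mem_set// /E /= dotvZ -w2 -exprMn.
  rewrite exprn_ege1// -ler_pdivrMr// mul1r//.
have H b := @ge_integral_expR_over_r R h (beta v) b w h0 h1 w0.
rewrite /g; have [bv0|bn0] := eqVneq (beta v) 0.
  rewrite leye_eq; apply/eqP/eqyP => A A0.
  (* This [b] solves [e^-1 ln (w / b) = A], so the integral exceeds every [A] and is infinite. *)
  have := H (w * expR (- (expR 1 * A))).
  rewrite mulr_gt0 ?expR_gt0// => /(_ isT).
  rewrite {1}bv0 mulr_ge0 ?expR_ge0 ?(ltW w0)// => /(_ isT).
  rewrite invfM mulrA divff ?gt_eqF// mul1r expRN invrK expRK mulrA.
  by rewrite -expRD addNr expR0 mul1r.
have bp : 0 < beta v by rewrite lt_neqAle eq_sym bn0.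
(* If the maximum is [1], then [g v = 0] and nonnegativity of the integrand suffices. *)
rewrite /Num.max; case: ifPn => _; last first.
  rewrite ln1 mul0r mulr0; apply: integral_ge0 => r.
  rewrite /= in_itv/= andbT => r0.
  by rewrite lee_fin mulr_ge0 ?h0// divr_ge0// expR_ge0.
have <- : ln (w / beta v) = ln (dotv v v / beta v ^+ 2) / 2.
  have wb : 0 < w / beta v by rewrite divr_gt0.
  rewrite -w2 -expr_div_n expr2 [in RHS]lnM ?posrE//.
  by field.
exact: H.
Qed.

(** The indicator of [E] is at most [min 1 |x|^2], so [nu E] is finite, and [g_le] bounds the
    integral of [g] by [nu E] in polar form. *)
Let integrable_g : alpha.-integrable S g.
Proof.
have [nu [nuE [_ nufin]]] := levy.
have mE : measurable E.
  have -> : E = [set: V] `&` (fun v : V => dotv v v) @^-1` `[1, +oo[.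
    by rewrite setTI; apply/seteqP; split=> x; rewrite /E /= in_itv/= andbT.
  exact: mdotv.
have nuEfin : (nu E < +oo)%E.
  apply: le_lt_trans nufin; rewrite -(setIT E) -integral_indic//.
  apply: ge0_subset_le_integral => // x _.
    rewrite !lee_fin indicE /=; case: (boolP (x \in E)).
      by rewrite inE /E/= => h; rewrite ler01 le_min lexx h.
    by rewrite lexx le_min ler01 dotv_ge0.
  by rewrite lee_fin le_min ler01 dotv_ge0.
apply/integrableP; split => //.
under eq_integral => v _ do rewrite gee0_abs//.
apply: le_lt_trans nuEfin; rewrite nuE// /gamma_levy.
(* The larger function is an inner integral whose measurability in [v] is not established. *)
apply: ge0_subset_le_integral => // v Sv; first by rewrite g_ge0 g_le.
exact: le_trans (g_ge0 v) (g_le Sv).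
Qed.

Lemma measurable_beta_eq0 : measurable (S `&` [set v | beta v = 0]).
Proof. by apply: (mbeta mS (Y := [set 0])). Qed.

(** [g] is [+oo] on this set, whereas an integrable function is finite almost everywhere. *)
Lemma alpha_beta_eq0 : alpha (S `&` [set v | beta v = 0]) = 0%E.
Proof.
have [Z [mZ Z0 h]] := integrable_ae mS integrable_g.
apply: (subset_measure0 measurable_beta_eq0 mZ _ Z0).
by move=> v [Sv /= bv]; apply: h => /= /(_ Sv); rewrite /g bv eqxx.
Qed.

(** By Cauchy-Schwarz, [1 + (v.z / beta)^2 <= (1 + |z|^2) max (1, |v|^2 / beta^2)]; taking
    logarithms bounds the function by [A + e g]. Where [beta] vanishes this bound is [+oo], so any
    value [c] is allowed. *)
Lemma integrable_ln_gamma (z : 'cV[R]_d) (c : R) :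
  alpha.-integrable S (EFin \o (fun v : V => if beta v == 0 then c else
    - (ln (1 + (dotv v z / beta v) ^+ 2) / 2))).
Proof.
pose A : R := ln (1 + dotv z z) / 2.
(* The factor [expR 1] undoes the [expR (- 1)] in [g]. *)
have iG : alpha.-integrable S (fun v => A%:E + (expR 1)%:E * g v)%E.
  apply: integrableD => //; first exact: finite_measure_integrable_cst.
  exact: integrableZl.
apply: (le_integrable _ _ _ iG) => //.
  apply/measurable_EFinP; apply: measurable_fun_if => //.
    exact: measurable_fun_beta_eq0.
  apply: measurableT_comp => //; apply: measurable_funM => //.
  apply: (measurableT_comp (@measurable_ln R)).
  apply: measurable_funD => //; apply: measurable_funX.
  apply: measurable_funM.
    apply: measurable_funTS.
    exact: (continuous_measurable_cV (@continuous_dotvr R d z)).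
  apply: (measurableT_comp (@measurable_invr R)).
  by apply: measurable_funS mbeta => //; exact: subIsetl.
move=> v Sv /=; rewrite /g; case: eqVneq => [_|bn0].
  by rewrite gt0_muley ?lte_fin ?expR_gt0// addey// leey.
have z0 := dotv_ge0 z; have v0 := dotv_ge0 v.
have b20 : 0 < beta v ^+ 2 by rewrite exprn_even_gt0.
set m := Num.max _ _; have m1 : 1 <= m by rewrite le_max lexx.
have m0 : 0 < m by exact: lt_le_trans m1.
have t1 : 1 <= 1 + (dotv v z / beta v) ^+ 2 by rewrite lerDl sqr_ge0.
have lem : 1 + (dotv v z / beta v) ^+ 2 <= (1 + dotv z z) * m.
  rewrite mulrDl mul1r lerD// expr_div_n.
  apply: (@le_trans _ _ (dotv z z * (dotv v v / beta v ^+ 2))).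
    rewrite mulrA ler_pM2r ?invr_gt0// mulrC; exact: dotv_Cauchy_Schwarz.
  by rewrite ler_wpM2l// le_max lexx orbT.
have tn : 0 <= ln (1 + (dotv v z / beta v) ^+ 2) / 2.
  by rewrite divr_ge0// ln_ge0.
rewrite -EFinM -EFinD /= lee_fin normrN (ger0_norm tn).
apply: le_trans (ler_norm _).
rewrite [expR 1 * _]mulrA -expRD subrr expR0 mul1r.
rewrite /A -mulrDl ler_pM2r ?invr_gt0// -lnM ?posrE//; last first.
  by rewrite ltr_wpDr.
by rewrite ler_ln ?posrE// ?(lt_le_trans _ t1)// mulr_gt0// ltr_wpDr.
Qed.

(** A bounded measurable function on a finite measure space, as [|atan| <= pi / 2]. *)
Lemma integrable_atan_gamma (z : 'cV[R]_d) (c : R) :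
  alpha.-integrable S (EFin \o (fun v : V => if beta v == 0 then c else
    atan (dotv v z / beta v))).
Proof.
have iG : alpha.-integrable S (cst (Num.max `|c| (pi / 2))%:E).
  exact: finite_measure_integrable_cst.
apply: (le_integrable _ _ _ iG) => //.
  apply/measurable_EFinP; apply: measurable_fun_if => //.
    exact: measurable_fun_beta_eq0.
  apply: measurableT_comp.
    by apply: continuous_measurable_fun => x; exact: continuous_atan.
  apply: measurable_funM.
    apply: measurable_funTS.
    exact: (continuous_measurable_cV (@continuous_dotvr R d z)).
  apply: (measurableT_comp (@measurable_invr R)).
  by apply: measurable_funS mbeta => //; exact: subIsetl.
move=> v Sv /=; rewrite lee_fin; apply: le_trans (ler_norm _).
case: ifP => _; rewrite le_max ?lexx//.
rewrite [X in _ || X]ler_norml.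
by rewrite (ltW (atan_gtNpi2 _)) (ltW (atan_ltpi2 _)) orbT.
Qed.

End GammaLevy.

(** * Passage from the radial integrals to the characteristic function *)

Theorem proposition3p10 (R : realType) (d : nat)
    (N : 'cV[R]_d -> R) (normN : is_norm N)
    (alpha : {finite_measure set (borelRd R d) -> \bar R})
    (beta : borelRd R d -> R)
    (mu : probability (borelRd R d) R)
    (gamma_mu : is_gamma N alpha beta mu) (z : 'cV[R]_d) :
  let f := fun v : borelRd R d =>
    cln ((beta v)%:C / ((beta v)%:C - 'i * (dotv v z)%:C)) in
  cintegrable alpha (unit_sphere N) f /\
  charfun mu z = cexp (cintegral alpha (unit_sphere N) f).
Proof.
case: gamma_mu => _ mbeta beta0 _ levy char /=.
set S := unit_sphere N; set f := fun v => cln _.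
(* The values at [beta v = 0] are kept so that the formula holds on all of [S]; they serve as the
   constants [c] of the two integrability lemmas. *)
have fE v : S v -> f v =
    (if beta v == 0 then ln 0
     else - (ln (1 + (dotv v z / beta v) ^+ 2) / 2)) +i*
    (if beta v == 0 then acos 0 else atan (dotv v z / beta v)).
  move=> Sv; rewrite /f; have [->|bn0] := eqVneq (beta v) 0.
    exact: cln_gamma0.
  by rewrite cln_gamma// lt_neqAle eq_sym bn0 beta0.
have mS : measurable S by exact: measurable_unit_sphere.
split; first split.
- apply: eq_integrable
    (integrable_ln_gamma normN beta0 mbeta levy z (ln 0)) => //.
  by move=> v; rewrite inE => Sv; rewrite [RHS]/comp fE.
- apply: eq_integrable
    (integrable_atan_gamma normN alpha mbeta z (acos 0)) => //.
  by move=> v; rewrite inE => Sv; rewrite [RHS]/comp fE.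
have mZ := measurable_beta_eq0 normN mbeta.
have Z0 := alpha_beta_eq0 normN beta0 mbeta levy.
rewrite char; congr cexp; rewrite /gamma_exponent {1 3}/cintegral.
have pos v : v \in S `\` (S `&` [set v | beta v = 0]) -> S v /\ 0 < beta v.
  rewrite inE => -[Sv /not_andP h]; split => //.
  rewrite lt_neqAle eq_sym beta0// andbT.
  by apply/eqP => b0; case: h.
(* Removing the null set [beta = 0] on both sides leaves [beta > 0], where the closed forms make the
   integrands equal pointwise. No measurability of the inner integrals in [v] is required. *)
congr (_ +i* _); rewrite /Rintegral (integral_setD_null _ _ mZ Z0);
  rewrite [in RHS](integral_setD_null _ _ mZ Z0); congr fine;
  apply: eq_integral => v /pos[Sv b0]; rewrite fE// gt_eqF//.
- congr EFin; rewrite [RHS]/= -(Rintegral_cos_frullani b0).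
  apply: eq_Rintegral => r _.
  by rewrite Re_cexpB1_mul [r * _]mulrC.
- congr EFin; rewrite [RHS]/= -(Rintegral_sin_frullani b0).
  apply: eq_Rintegral => r _.
  by rewrite Im_cexpB1_mul [r * _]mulrC.
Qed.
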